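(* Let $\sigma$ be a primitive pseudo-unimodular substitution over a finite alphabet $A$ with at least two letters. If the Perron eigenvalue $\beta$ of the incidence matrix of $\sigma$ is not a Pisot number, then the subshift $(\Omega_\sigma,S)$ has strictly fewer rationally independent eigenvalues than the degree of $\beta$; that is, whenever $\alpha_1,\dots,\alpha_k\in\mathbb{R}$ are linearly independent over $\mathbb{Q}$ and $e^{2i\pi\alpha_1},\dots,e^{2i\pi\alpha_k}$ are eigenvalues of $(\Omega_\sigma,S)$, we have $k<\deg(\beta)$.
   Context: A substitution over a finite alphabet $A$ is a morphism $\sigma:A^*\to A^*$ of the free monoid with $|\sigma(a)|\ge 1$ for all $a\in A$. Its incidence matrix is $M_\sigma=(|\sigma(a)|_b)_{(b,a)\in A^2}$, where $|\sigma(a)|_b$ is the number of occurrences of $b$ in $\sigma(a)$ (row index $b$, column index $a$). $\sigma$ is primitive if some power $M_\sigma^n$, $n\ge1$, has all entries strictly positive; the Perron eigenvalue is then the simple real eigenvalue equal to the spectral radius. A matrix is pseudo-unimodular if the product of all its non-zero eigenvalues, counted with multiplicity, is $\pm1$; $\sigma$ is pseudo-unimodular if $M_\sigma$ is. A Pisot number is an algebraic integer $\beta>1$ all of whose conjugates $\gamma\neq\beta$ satisfy $|\gamma|<1$. The degree of an algebraic number is the degree of its minimal polynomial over $\mathbb{Q}$. $S:A^{\mathbb{Z}}\to A^{\mathbb{Z}}$ is the shift $(u_i)_i\mapsto(u_{i+1})_i$, and $\Omega_\sigma$ is the smallest non-empty compact subset of $A^{\mathbb{Z}}$ invariant under $\sigma$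 and $S$. A complex number $\eta$ of modulus one is an eigenvalue of $(\Omega_\sigma,S)$ if there is a continuous $f:\Omega_\sigma\to\{z\in\mathbb{C}:|z|=1\}$ with $f\circ S=\eta f$. *)

(* Defs.v *)
From HB Require Import structures.
From mathcomp Require Import all_boot all_order all_algebra.
From mathcomp Require Import complex.
From mathcomp Require Import all_classical all_reals all_analysis.
Set Implicit Arguments.
Unset Strict Implicit.
Unset Printing Implicit Defensive.
Import Order.TTheory GRing.Theory Num.Theory.
Import numFieldTopology.Exports numFieldNormedType.Exports.
Local Open Scope classical_set_scope.
Local Open Scope ring_scope.

(* R[i] is bundled as a numClosedFieldType, because mathcomp-analysis derives
   the topology and the norm of a field from such a structure. *)
Definition Cplx (R : realType) : numClosedFieldType := R[i].

(** * Substitutions *)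

(* [sigma [::] = [::]] follows from [subst_cat]. *)
Record substitution (A : finType) := Substitution {
  subst_fun :> seq A -> seq A ;
  subst_cat : {morph subst_fun : u v / u ++ v} ;
  subst_nonerasing : forall a : A, (1 <= size (subst_fun [:: a]))%N }.

Definition incidence_matrix (A : finType) (sigma : substitution A) :
    'M[int]_#|A| :=
  \matrix_(b, a) (count_mem (enum_val b) (sigma [:: enum_val a]))%:Z.

Definition primitive_matrix (n : nat) (M : 'M[int]_n) :=
  exists2 m : nat, (1 <= m)%N & forall i j, 0 < (M ^+ m) i j.

Definition primitive_substitution (A : finType) (sigma : substitution A) :=
  primitive_matrix (incidence_matrix sigma).

(** * Spectra of integer matrices *)

(* The complex eigenvalues, listed with algebraic multiplicity. *)
Definition spectrum (R : realType) (n : nat) (M : 'M[int]_n) : seq (Cplx R) :=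
  sval (closed_field_poly_normal
          (map_poly (intr : int -> Cplx R) (char_poly M))).

Definition pseudo_unimodular_matrix (R : realType) (n : nat) (M : 'M[int]_n) :=
  let p := \prod_(l <- spectrum R M | l != 0) l in p = 1 \/ p = -1.

Definition pseudo_unimodular (R : realType) (A : finType)
    (sigma : substitution A) :=
  pseudo_unimodular_matrix R (incidence_matrix sigma).

(* [b] is a simple real eigenvalue and is the maximum of the moduli of the
   eigenvalues. *)
Definition perron_eigenvalue (R : realType) (n : nat) (M : 'M[int]_n)
    (b : Cplx R) :=
  [/\ b \is Num.real, count_mem b (spectrum R M) = 1%N &
      forall l, l \in spectrum R M -> `|l| <= b].

(** * Algebraic numbers *)

(* The default value 0 is taken exactly when [x] is transcendental. *)
Definition minpolyQ (R : realType) (x : Cplx R) : {poly rat} :=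
  xget 0 [set p : {poly rat} | p \is monic /\
    forall q : {poly rat}, root (map_poly ratr q) x = (p %| q)].

Definition alg_degree (R : realType) (x : Cplx R) : nat :=
  (size (minpolyQ x)).-1.

(* In the order of R[i], [1 < b] entails that [b] is real. *)
Definition pisot (R : realType) (b : Cplx R) :=
  [/\ integralOver (intr : int -> Cplx R) b, 1 < b &
      forall g : Cplx R, root (map_poly ratr (minpolyQ b)) g -> g != b ->
        `|g| < 1].

Definition free_over_Q (R : realType) (k : nat) (alpha : 'I_k -> R) :=
  forall c : 'I_k -> rat,
    \sum_(i < k) ratr (c i) * alpha i = 0 -> forall i, c i = 0.

(** * The subshift of a substitution *)

Definition biinf (A : finType) :=
  prod_topology (fun _ : int => discrete_topology A).

Definition shift (A : finType) (u : biinf A) : biinf A := fun i => u (i + 1).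

(* Image of a bi-infinite word: ... sigma(u_-2) sigma(u_-1) . sigma(u_0) ...,
   where sigma(u_0) starts at index 0 and sigma(u_-1) ends at index -1.
   As sigma is non-erasing, the letter of index n is letter n of
   sigma(u_0 ... u_n), and the letter of index Negz n = -(n+1) is the
   (n+1)-st letter from the right of sigma(u_-(n+1) ... u_-1); hence the default
   letter of [nth] is never reached. *)
Definition subst_biinf (A : finType) (sigma : substitution A) (u : biinf A) :
    biinf A :=
  fun i : int =>
    match i with
    | Posz n => nth (u 0 : A) (sigma (mkseq (fun j => u (Posz j) : A) n.+1)) n
    | Negz n =>
        nth (u 0 : A)
          (rev (sigma (rev (mkseq (fun j => u (Negz j) : A) n.+1)))) n
    end.

Definition invariant_compact (A : finType) (sigma : substitution A)
    (X : set (biinf A)) :=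
  [/\ X !=set0, compact X, subst_biinf sigma @` X `<=` X &
      @shift A @` X `<=` X].

Definition Omega (A : finType) (sigma : substitution A) : set (biinf A) :=
  smallest (invariant_compact sigma) set0.

(** * Eigenvalues of the subshift *)

(* Only the values of [f] on Omega matter; its continuity is that of the
   restriction of [f] to the subspace Omega. *)
Definition subshift_eigenvalue (R : realType) (A : finType)
    (sigma : substitution A) (eta : Cplx R) :=
  `|eta| = 1 /\
  exists f : biinf A -> Cplx R,
    [/\ {within Omega sigma, continuous f},
        forall u, Omega sigma u -> `|f u| = 1 &
        forall u, Omega sigma u -> f (shift u) = eta * f u].

Definition expi2pi (R : realType) (a : R) : Cplx R :=
  (cos (2 * pi * a) +i* sin (2 * pi * a))%C.

(* Main.v *)
Require Import Defs.
From mathcomp Require Import all_boot all_order all_algebra.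
From mathcomp Require Import complex spectral.
From mathcomp Require Import all_classical all_reals all_analysis.
From mathcomp Require Import zify ring lra.

(** The argument compares two expansions of one sequence. Let [M] be the
    incidence matrix, [q] its characteristic polynomial, and let [w] be a
    non-empty word such that [w a], with [a] the first letter of [w], occurs in
    some [u] of Omega. Put [s n = |sigma^n w|]; this integer sequence satisfies
    the linear recurrence of characteristic polynomial [q].

    If [e^(2 i pi alpha)] is an eigenvalue with eigenfunction [f], then the
    points obtained by shifting [sigma^n u] to the middle of its first block
    [sigma^n a], and to the middle of the block [sigma^n a] that lies [s n]
    letters further, agree on a window whose length tends to infinity. As [f] is
    uniformly continuous on the compact set Omega, [alpha * s n] tends to [0]
    modulo [1] ([eigenvalue_return_times]; a criterion of Host). Write
    [alpha * s n = p n + eps n] with [p n] an integer and [eps n -> 0]. The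
    recurrence applied to [eps] gives integers that tend to [0], so from some
    rank on [p] and [eps] satisfy it as well. A recurrent sequence that tends to
    [0] has no component along [x^n] when [x] is a root of [q] with [1 <= |x|]
    ([root_coord_vanish]). Thus, writing [c_x] for the component along [x^n],
    [alpha * c_x(s) = c_x(p)] for all these [x], and both sides are values at
    [x] of rational polynomials which do not depend on [x]
    ([eigenvalue_coord_poly]).

    This applies to [x = beta], as [1 < beta]. Because [beta] is an algebraic
    integer and is not a Pisot number, it also applies to a conjugate
    [gamma <> beta] with [1 <= |gamma|]. Moreover [c_beta(s) <> 0]: the lengths
    [s n] lie between two positive multiples of [beta^n], and [beta] is a simple
    root ([root_coord_neq0]). So every [alpha] lies in [Q(beta)] and is fixed by
    the embedding [beta |-> gamma]; such elements form a proper subfield of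
    [Q(beta)], hence a [Q]-subspace of dimension less than [deg beta]
    ([conjugate_rank]).

    None of this says anything unless Omega is non-empty, which is where
    primitivity enters a second time: a limit of the words [sigma^n c], centred
    at the origin, lies in every non-empty compact invariant set
    ([Omega_nonempty]). *)

Set Implicit Arguments.
Unset Strict Implicit.
Unset Printing Implicit Defensive.
Import Order.TTheory GRing.Theory Num.Theory.
Import numFieldTopology.Exports numFieldNormedType.Exports.
Local Open Scope classical_set_scope.
Local Open Scope ring_scope.

(** * Bi-infinite words as a compact space *)

(** The window is [-N, N[, split into its two halves because [int] has two
    constructors. *)
Definition agree (A : finType) (N : nat) (u x : biinf A) :=
  forall n : nat, (n < N)%N -> x (Posz n) = u (Posz n) /\
    x (Negz n) = u (Negz n).

Lemma agree_nbhs (A : finType) (N : nat) (u : biinf A) :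
  nbhs u [set x | agree N u x].
Proof.
have h (i : int) : \forall x \near u, x i = u i.
  have := @proj_continuous int (fun=> discrete_topology A) i u.
  move=> /(_ [set u i]); apply.
  exact: (@discrete_set1 (discrete_topology A)).
have FF : Filter (nbhs u) by exact: (@nbhs_filter (biinf A) u).
have := @filter_forall (biinf A) _
  (fun (k : 'I_N) x => x (Posz k) = u (Posz k) /\ x (Negz k) = u (Negz k))
    (nbhs u) FF.
move=> H; apply: filterS (H _) => [x hx n nN|k]; first exact: (hx (Ordinal nN)).
by apply: filterS2 (h (Posz k)) (h (Negz k)) => x.
Qed.

Lemma nbhs_agree (A : finType) (u : biinf A) (U : set (biinf A)) :
  nbhs u U -> exists N, [set x | agree N u x] `<=` U.
Proof.
pose F := filter_from [set: nat] (fun N => [set x : biinf A | agree N u x]).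
have FF : Filter F.
  apply: filter_from_filter; first by exists 0%N.
  move=> i j _ _; exists (maxn i j) => // x hx; split=> n hn; apply: hx;
    by rewrite (leq_trans hn) // ?leq_maxl ?leq_maxr.
suff Fu : F --> u by move=> /Fu [N _ h]; exists N.
apply/cvg_sup => i V; rewrite nbhsE => -[B [[W oW WB] uB] BV].
exists (`|i|.+1)%N => // x hx; apply: BV; rewrite -WB /=.
rewrite -WB /= in uB.
suff -> : x i = u i by [].
clear -hx; case: i hx => n hx.
  by have [->] := hx n (ltnSn n).
by have [_ ->] := hx n (leqW (ltnSn n)).
Qed.

Lemma biinf_hausdorff (A : finType) : hausdorff_space (biinf A).
Proof.
apply: hausdorff_product => _.
exact: discrete_hausdorff.
Qed.

Lemma biinf_compact (A : finType) : compact [set: biinf A].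
Proof.
have := @tychonoff int (fun=> discrete_topology A) (fun=> setT).
have -> : [set f : forall i : int, discrete_topology A | forall i,
  [set: discrete_topology A] (f i)] = setT.
  by apply/seteqP; split.
apply=> _; apply: finite_compact.
exact: (@finite_finset A).
Qed.

(** The Heine-Cantor theorem, with windows in place of a metric. *)
Lemma compact_unif_continuous (R : realType) (A : finType) (X : set (biinf A))
    (f : biinf A -> Cplx R) :
  compact X -> {within X, continuous f} -> forall e : Cplx R, 0 < e ->
  exists N, forall x y, X x -> X y -> agree N x y -> `|f x - f y| < e.
Proof.
move=> cX /subspace_continuousP cf e e0; apply: contrapT => /forallNP H.
have /choice [xy xyP] : forall N, exists xy : biinf A * biinf A,
    [/\ X xy.1, X xy.2, agree N xy.1 xy.2 & ~ (`|f xy.1 - f xy.2| < e)].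
  move=> N; have /existsNP [x /existsNP [y]] := H N.
  move=> /not_implyP [Ox /not_implyP [Oy /not_implyP [ag ne]]].
  by exists (x, y).
pose x N := (xy N).1.
have xF : (x @ \oo) X by exists 0%N => // n _; have [] := xyP n.
have [u [Ou cu]] := cX _ _ xF.
have e20 : 0 < e / 2 by rewrite divr_gt0.
have /cvgrPdist_lt /(_ _ e20) := cf u Ou.
move=> /nbhs_agree [N NU].
have [] := cu [set x n | n in [set n | (N <= n)%N]] [set z | agree N u z].
- by exists N => // n /= Nn; exists n.
- exact: agree_nbhs.
move=> _ [[n /= Nn <-] ag].
have [Ox Oy ag' []] := xyP n.
have h1 := NU _ ag Ox.
have ag2 : agree N u (xy n).2.
  move=> k kN; have [<- <-] := ag k kN; apply: ag'; exact: leq_trans kN Nn.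
have h2 := NU _ ag2 Oy.
rewrite [e](splitr e) (_ : _ - _ = (f u - f (xy n).2) - (f u - f (xy n).1));
  last by ring.
rewrite (le_lt_trans (ler_normB _ _)) // ltrD //.
Qed.

(** * Words and their images *)

Section Words.
Variables (A : finType) (sigma : substitution A).
Implicit Types (u v w : seq A) (x : biinf A).

Lemma subst_nil : sigma [::] = [::].
Proof.
apply: size0nil; have /(congr1 size) := subst_cat sigma [::] [::].
rewrite cats0 size_cat => h; lia.
Qed.

Lemma size_subst w : (size w <= size (sigma w))%N.
Proof.
elim: w => // a w IH.
rewrite -cat1s subst_cat !size_cat leq_add //=; exact: subst_nonerasing.
Qed.

Lemma iter_subst_cat n : {morph iter n sigma : u v / u ++ v}.
Proof. by move=> u v; elim: n => //= n ->; rewrite subst_cat. Qed.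

Lemma size_iter_subst n w : (size w <= size (iter n sigma w))%N.
Proof. by elim: n => //= n IH; rewrite (leq_trans IH) ?size_subst. Qed.

Definition starts x w := mkseq (fun j => x (Posz j) : A) (size w) = w.

Lemma startsP x w :
  starts x w <-> forall a i, (i < size w)%N -> x (Posz i) = nth a w i.
Proof.
split=> [h a i iw|h]; first by rewrite -{1}h nth_mkseq.
have sz : size (mkseq (fun j => x (Posz j) : A) (size w)) = size w.
  by rewrite size_mkseq.
apply: (@eq_from_nth _ (x 0)) => // i; rewrite sz => iw.
by rewrite nth_mkseq //; exact: h.
Qed.

Lemma starts_catl x u v : starts x (u ++ v) -> starts x u.
Proof.
move=> /startsP h; apply/startsP => a i iu.
by rewrite (h a) ?size_cat ?ltn_addr // nth_cat iu.
Qed.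

Lemma mkseq_le (f : nat -> A) n m : (n <= m)%N ->
  exists t, mkseq f m = mkseq f n ++ t.
Proof.
move=> nm; exists (map f (iota n (m - n))).
by rewrite /mkseq -map_cat -[n in iota n _]add0n -iotaD subnKC.
Qed.

(** Reading the defining formula of [subst_biinf] at the indices [i >= 0]: the
    images of two prefixes of the same word agree on their common length. All
    that follows about [subst_biinf] rests on these indices alone. *)
Lemma starts_subst x w : starts x w -> starts (subst_biinf sigma x) (sigma w).
Proof.
move=> xw; apply/startsP => a i iw /=.
have szi : (i < size (sigma (mkseq (fun j : nat => x j : A) i.+1)))%N.
  by rewrite (leq_trans _ (size_subst _)) // size_mkseq.
rewrite (set_nth_default a) // -xw; rewrite -xw in iw.
have [iw'|/ltnW iw'] := leqP i.+1 (size w).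
  have [t ->] := mkseq_le (fun j : nat => x j) iw'.
  by rewrite [in RHS]subst_cat nth_cat szi.
have [t ->] := mkseq_le (fun j : nat => x j) iw'.
by rewrite [in LHS]subst_cat nth_cat iw.
Qed.

Lemma starts_iter_subst n x w :
  starts x w -> starts (iter n (subst_biinf sigma) x) (iter n sigma w).
Proof. by move=> xw; elim: n => //= n; exact: starts_subst. Qed.

Lemma iter_shiftE k x i : iter k (@Defs.shift A) x i = x (i + k%:Z).
Proof.
elim: k i => [|k IH] i /=; first by rewrite addr0.
by rewrite /Defs.shift IH; congr x; lia.
Qed.

Lemma starts_shift x u v : starts x (u ++ v) ->
  starts (iter (size u) (@Defs.shift A) x) v.
Proof.
move=> /startsP h; apply/startsP => a i iv.
rewrite iter_shiftE -PoszD (h a) ?size_cat; last lia.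
rewrite nth_cat; case: ltnP => [|_]; first lia.
by congr nth; lia.
Qed.

Lemma count_subst w (b : 'I_#|A|) :
  (count_mem (enum_val b) (sigma w))%:Z =
  \sum_(a < #|A|) incidence_matrix sigma b a * (count_mem (enum_val a) w)%:Z.
Proof.
elim: w => [|c w IH].
  by rewrite subst_nil /= big1 // => a _; rewrite mulr0.
rewrite -cat1s subst_cat count_cat PoszD IH.
under [in RHS]eq_bigr do rewrite count_cat PoszD mulrDr.
rewrite big_split /=; congr (_ + _).
rewrite (bigD1 (enum_rank c)) //= enum_rankK eqxx big1 ?addr0 ?mulr1.
  by rewrite mxE enum_rankK.
move=> i /eqP ic; case: eqP => [cE|_]; last by rewrite mulr0.
by case: ic; rewrite cE enum_valK.
Qed.

Definition count_vec w : 'cV[int]_#|A| := \col_a (count_mem (enum_val a) w)%:Z.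

Lemma count_vec_subst w :
  count_vec (sigma w) = incidence_matrix sigma *m count_vec w.
Proof.
by apply/colP => b; rewrite mxE count_subst mxE; apply: eq_bigr => a _;
  rewrite !mxE.
Qed.

Lemma count_vec_iter n w :
  count_vec (iter n sigma w) = (incidence_matrix sigma ^+ n) *m count_vec w.
Proof.
elim: n => [|n IH] /=; first by rewrite expr0 mul1mx.
by rewrite count_vec_subst IH mulmxA exprS.
Qed.

Lemma size_count_vec w : (size w)%:Z = \sum_a count_vec w a 0.
Proof.
elim: w => [|c w IH]; first by rewrite big1 // => a _; rewrite mxE.
under eq_bigr do rewrite mxE /= PoszD.
rewrite big_split /= -add1n PoszD IH; congr (_ + _).
  rewrite (bigD1 (enum_rank c)) //= enum_rankK eqxx big1 ?addr0 //.
  move=> i /eqP ic; case: eqP => [cE|//].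
  by case: ic; rewrite cE enum_valK.
by apply: eq_bigr => a _; rewrite mxE.
Qed.

Hypothesis cardA : (2 <= #|A|)%N.
Hypothesis prim : primitive_substitution sigma.

Lemma primitive_mem : exists m, forall a b : A, b \in iter m sigma [:: a].
Proof.
have [m _ mP] := prim; exists m => a b.
have := congr1 (fun M : 'cV_ _ => M (enum_rank b) 0) (count_vec_iter m [:: a]).
rewrite mxE enum_rankK mxE => E.
rewrite -has_pred1 has_count -ltz_nat E.
rewrite (bigD1 (enum_rank a)) //= ltr_pwDl //.
  by rewrite mxE /= enum_rankK eqxx mulr1; exact: mP.
by apply: sumr_ge0 => i _; rewrite mulr_ge0 ?mxE // ltW //; exact: mP.
Qed.

(** Some power of the substitution maps each letter to a word containing every
    letter, hence at least two letters. *)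
Lemma size_iter_double : exists m, forall w,
  (2 * size w <= size (iter m sigma w))%N.
Proof.
have [m mP] := primitive_mem; exists m.
have h a : (2 <= size (iter m sigma [:: a]))%N.
  apply: leq_trans cardA _; rewrite cardE; apply: uniq_leq_size => [|b _].
    exact: enum_uniq.
  exact: mP.
elim=> [|a w IH]; first by rewrite muln0.
by rewrite -cat1s iter_subst_cat !size_cat mulnDr leq_add //= h.
Qed.

Lemma size_iter_unbounded N : exists M, forall n, (M <= n)%N ->
  forall w, w != [::] -> (N <= size (iter n sigma w))%N.
Proof.
have [m mP] := size_iter_double.
elim: N => [|N [M IH]]; first by exists 0%N.
exists (m + M)%N => n nM w w0.
have -> : n = (m + (n - m))%N by lia.
rewrite iterD; have := mP (iter (n - m) sigma w).
have := IH (n - m)%N ltac:(lia) w w0.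
have := size_iter_subst (n - m) w.
have : (0 < size w)%N by case: w w0.
lia.
Qed.

End Words.

(** * Points of the subshift and return times *)

Section OmegaFacts.
Variables (A : finType) (sigma : substitution A).
Hypothesis cardA : (2 <= #|A|)%N.
Hypothesis prim : primitive_substitution sigma.
Implicit Types (u v w : seq A) (x : biinf A).

Local Notation sh := (@Defs.shift A).
Local Notation Om := (Omega sigma).

Lemma OmegaP x : Om x <-> forall X, invariant_compact sigma X -> X x.
Proof.
split=> [h X XP|h X [XP _]]; last exact: h.
by apply: h; split.
Qed.

Lemma Omega_subst n x : Om x -> Om (iter n (subst_biinf sigma) x).
Proof.
move=> Ox; elim: n => //= n /OmegaP IH; apply/OmegaP => X XP.
have [_ _ s _] := XP; apply: s; exists (iter n (subst_biinf sigma) x) => //.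
exact: IH.
Qed.

Lemma Omega_shift n x : Om x -> Om (iter n sh x).
Proof.
move=> Ox; elim: n => //= n /OmegaP IH; apply/OmegaP => X XP.
have [_ _ _ s] := XP; apply: s; exists (iter n sh x) => //.
exact: IH.
Qed.

Lemma Omega_compact : compact Om.
Proof.
apply: (@subclosed_compact _ _ setT) => //; last exact: biinf_compact.
have -> : Om = \bigcap_(X in [set X | invariant_compact sigma X]) X.
  apply/seteqP; split=> x; first by move=> /OmegaP h X; exact: h.
  by move=> h; apply/OmegaP => X XP; exact: h.
apply: closed_bigI => X [_ cX _ _].
exact: compact_closed (@biinf_hausdorff A) cX.
Qed.

(** Centre [sigma^n c] at the origin and take a cluster point [u] as [n] grows.
    For any point [z] of an invariant set, [c] occurs at a non-negative index of
    [sigma^m z] for some [m]; applying [sigma^n] and shifting produces a point of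
    that set which agrees with [u] on a given window. A closed invariant set thus
    contains [u]. *)
Lemma Omega_nonempty : Om !=set0.
Proof.
have [c _] : exists c : A, c \in A.
  by apply/card_gt0P; exact: leq_trans cardA.
pose w n := iter n sigma [:: c].
pose y n : biinf A := fun i : int =>
  nth c (w n) (absz (i + (size (w n))./2%:Z)).
have yF : (y @ \oo) [set: biinf A] by exists 0%N.
have [u [_ cu]] := @biinf_compact A (y @ \oo) _ yF.
exists u; apply/OmegaP => X [[z Xz] cX sX hX].
have cl : closed X by exact: compact_closed (@biinf_hausdorff A) cX.
have sXn n x : X x -> X (iter n (subst_biinf sigma) x).
  by move=> Xx; elim: n => //= n IH; apply: sX;
    exists (iter n (subst_biinf sigma) x).
have hXn n x : X x -> X (iter n sh x).
  by move=> Xx; elim: n => //= n IH; apply: hX; exists (iter n sh x).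
apply: cl => U /nbhs_agree [N NU].
have [M MP] := size_iter_unbounded cardA prim (N.+1).*2.
have [] := cu [set y n | n in [set n | (M <= n)%N]] [set x | agree N u x].
- by exists M => // n /= Mn; exists n.
- exact: agree_nbhs.
move=> _ [[n /= Mn <-] ag].
have [m mem] := primitive_mem prim.
have sz := MP n Mn [:: c] isT; rewrite -/(w n) in sz.
have st : starts (iter n (subst_biinf sigma) (iter m (subst_biinf sigma) z))
   (iter n sigma (iter m sigma [:: z 0 : A])).
  by do 2!apply: starts_iter_subst.
move: st; have := mem (z 0) c; move: (iter m sigma _) => W; case/splitPr => p q.
rewrite -cat1s !iter_subst_cat => /starts_shift /starts_catl.
(* [z'] is a shift of [sigma^(n+m) z] that starts with [sigma^n c]. *)
set z' := iter _ sh _ => /startsP st.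
have Xz' : X z' by exact/hXn/sXn/sXn.
exists (iter (size (w n))./2 sh z'); split; first exact: hXn.
apply: NU => k kN; have [<- <-] := ag k kN.
rewrite !iter_shiftE /y; rewrite -/(w n) in st.
have h3 : (N.+1 <= (size (w n))./2)%N by rewrite -(doubleK N.+1) half_leq.
have h4 : ((size (w n))./2 + (size (w n))./2 <= size (w n))%N.
  by rewrite addnn -[leqRHS]odd_double_half leq_addl.
split.
  have -> : (k%:Z + ((size (w n))./2)%:Z)%R = Posz (k + (size (w n))./2) by [].
  by rewrite (st c) // ; lia.
have -> : (Negz k + ((size (w n))./2)%:Z)%R = Posz ((size (w n))./2 - k.+1)
  by lia.
by rewrite (st c) //; lia.
Qed.

(** Pigeonhole on the letters at indices [0 .. #|A|]. *)
Lemma return_word : exists x a v, Om x /\ starts x (a :: rcons v a).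
Proof.
have [u Ou] := Omega_nonempty.
have : ~~ injectiveb (fun k : 'I_#|A|.+1 => u (Posz k) : A).
  apply/negP => /injectiveP inj.
  by have := leq_card _ inj; rewrite card_ord ltnn.
move=> /injectivePn [i [j ij uij]].
wlog lt_ij : i j ij uij / (i < j)%N.
  move=> H; case: (ltngtP i j) => [|ji|/val_inj/eqP]; first exact: H.
    by apply: (H j i); rewrite 1?eq_sym.
  by rewrite (negPf ij).
exists (iter i sh u), (u (Posz i)),
  (mkseq (fun k => u (Posz (i + k.+1)) : A) (j - i.+1)).
split; first exact: Omega_shift.
apply/startsP => a [|k] /=;
  rewrite iter_shiftE ?add0r // size_rcons size_mkseq => kj.
rewrite nth_rcons size_mkseq; case: ltnP => h.
  by rewrite nth_mkseq //; congr u; lia.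
rewrite ifT; last lia.
rewrite uij; congr u; rewrite -PoszD; congr Posz;
  move: (nat_of_ord i) (nat_of_ord j) h kj lt_ij => a' b'; clear=> h kj ab; lia.
Qed.

(** Let [w = a v] and let [u] in Omega start with [w a]. The point
    [x = sigma^n u] has the block [sigma^n a] at index [0] and again at index
    [|sigma^n w|]. Moved to the middles of these two blocks, the origin sees the
    same letters on a window growing with [n], while [f] gets multiplied by
    [eta ^ |sigma^n w|]. The word [w] is the same for all [eta]. *)
Lemma eigenvalue_return_times (R : realType) : exists2 w : seq A, w != [::] &
  forall eta : Cplx R, subshift_eigenvalue sigma eta ->
  forall e : Cplx R, 0 < e ->
  exists N, forall n, (N <= n)%N -> `|eta ^+ size (iter n sigma w) - 1| < e.
Proof.
have [u [a [v [Ou ust]]]] := return_word.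
exists (a :: v) => // eta [eta1 [f [cf f1 fS]]] e e0.
have fSn n x : Om x -> f (iter n sh x) = eta ^+ n * f x.
  move=> Ox; elim: n => [|n IH] /=; first by rewrite expr0 mul1r.
  by rewrite fS ?IH ?exprS ?mulrA //; exact: Omega_shift.
have [N NP] := compact_unif_continuous Omega_compact cf e0.
have [M MP] := size_iter_unbounded cardA prim (N.+1).*2.
exists M => n Mn.
set W := iter n sigma (a :: v); set w := iter n sigma [:: a].
pose x := iter n (subst_biinf sigma) u.
have Ox : Om x by exact: Omega_subst.
have sz : ((N.+1).*2 <= size w)%N by exact: MP.
have st1 : starts x w.
  apply: starts_iter_subst; apply: (@starts_catl _ _ _ (rcons v a)); exact: ust.
have st2 : starts (iter (size W) sh x) w.
  apply: starts_shift; rewrite -iter_subst_cat; apply: starts_iter_subst.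
  by rewrite cats1.
move: st1 st2 => /startsP st1 /startsP st2.
have h3 : (N.+1 <= (size w)./2)%N by rewrite -(doubleK N.+1) half_leq.
have h4 : ((size w)./2 + (size w)./2 <= size w)%N.
  by rewrite addnn -[leqRHS]odd_double_half leq_addl.
pose h := (size w)./2.
have := NP (iter h sh x) (iter h sh (iter (size W) sh x)).
have O2 := Omega_shift (size W) Ox.
rewrite (fSn h x Ox) (fSn h _ O2) (fSn _ x Ox).
rewrite (_ : _ - _ = - (eta ^+ h * f x * (eta ^+ size W - 1))); last by ring.
rewrite normrN !normrM normrX eta1 expr1n f1 // !mul1r; apply.
- exact: Omega_shift.
- by do 2!apply: Omega_shift.
move=> k kN; rewrite !(iter_shiftE h).
split.
  have -> : (k%:Z + h%:Z)%R = Posz (k + h) by [].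
  rewrite (st1 a) ?(st2 a) //; rewrite /h; lia.
have -> : (Negz k + h%:Z)%R = Posz (h - k.+1) by rewrite /h; lia.
rewrite (st1 a) ?(st2 a) //; rewrite /h; lia.
Qed.

End OmegaFacts.

(** * Powers of a primitive matrix *)

Section TriangularMatrices.
Variables (F : comNzRingType) (n : nat).
Implicit Types T U : 'M[F]_n.

Lemma trigmx_mul T U : is_trig_mx T -> is_trig_mx U ->
  is_trig_mx (T *m U) /\ forall i, (T *m U) i i = T i i * U i i.
Proof.
move=> /is_trig_mxP tT /is_trig_mxP tU; split.
  apply/is_trig_mxP => i j ij; rewrite mxE big1 // => l _.
  have [il|li] := ltnP i l; first by rewrite tT ?mul0r.
  by rewrite tU ?mulr0 // (leq_ltn_trans li).
move=> i; rewrite mxE (bigD1 i) //= big1 ?addr0 // => l.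
rewrite neq_ltn => /orP[li|il]; first by rewrite tU ?mulr0.
by rewrite tT ?mul0r.
Qed.

Lemma trigmx_exp T k : is_trig_mx T ->
  is_trig_mx (T ^+ k) /\ forall i, (T ^+ k) i i = T i i ^+ k.
Proof.
move=> tT; elim: k => [|k [IH1 IH2]].
  by split=> [|i]; rewrite ?expr0 ?scalar_mx_is_trig // mxE eqxx.
have [h1 h2] := trigmx_mul tT IH1; rewrite exprS; split=> // i.
by rewrite h2 IH2 exprS.
Qed.
End TriangularMatrices.

(** By Schur triangularization, the trace of [M ^+ k] is the sum of the [k]-th
    powers of the eigenvalues. *)
Lemma mxtrace_exp_le (C : numClosedFieldType) n (M : 'M[C]_n) (b : C) k :
  (forall l, root (char_poly M) l -> `|l| <= b) ->
  `|\tr (M ^+ k)| <= n%:R * b ^+ k.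
Proof.
case: n M => [|n] M Mb; first by rewrite /mxtrace big_ord0 normr0 mul0r.
have [P Pu Ptrig] := Schur M (ltn0Sn n).
have Pun := unitarymx_unit Pu.
pose T := P *m M *m invmx P.
have trigT : is_trig_mx T by move: Ptrig; rewrite /similar_to conjumx.
have Tk j : T ^+ j = P *m (M ^+ j) *m invmx P.
  elim: j => [|j IH]; first by rewrite !expr0 mulmx1 mulmxV.
  by rewrite exprS IH -mulmxE /T -!mulmxA mulKmx // exprS -mulmxE !mulmxA.
have -> : \tr (M ^+ k) = \tr (T ^+ k).
  by rewrite Tk mxtrace_mulC mulmxA mulVmx // mul1mx.
have [_ Tii] := trigmx_exp k trigT.
rewrite /mxtrace (le_trans (ler_norm_sum _ _ _)) //.
rewrite -[X in X%:R](card_ord n.+1) -sumr_const mulr_suml ler_sum // => i _.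
have Mi : `|T i i| <= b.
  apply: Mb; rewrite -eigenvalue_root_char.
  apply: (@eigenvalue_conjmx _ _ _ P); rewrite ?stablemx_unit ?row_free_unit //.
  rewrite conjumx // -/T [_ \in _]eigenvalue_root_char char_poly_trig //.
  by rewrite (bigD1 i) //= rootM root_XsubC eqxx.
by rewrite mul1r Tii normrX lerXn2r ?nnegrE // (le_trans _ Mi).
Qed.

Section PrimitiveMatrix.
Variables (C : numClosedFieldType) (n : nat) (M : 'M[int]_n).
Hypothesis M_ge0 : forall i j, 0 <= M i j.
Local Notation MC := (map_mx (intr : int -> C) M).

Lemma map_mx_intr_exp k : MC ^+ k = map_mx (intr : int -> C) (M ^+ k).
Proof.
elim: k => [|k IH]; first by rewrite !expr0 map_scalar_mx /= rmorph1.
by rewrite !exprS IH -!mulmxE map_mxM.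
Qed.

Lemma expmx_ge0 k i j : 0 <= (M ^+ k) i j.
Proof.
elim: k i j => [|k IH] i j; first by rewrite expr0 mxE; case: (i == j).
by rewrite exprS mxE sumr_ge0 // => l _; rewrite mulr_ge0.
Qed.

Variables (b : C) (m : nat).
Hypothesis b_max : forall l, root (char_poly MC) l -> `|l| <= b.
Hypothesis Mm_gt0 : forall i j, 0 < (M ^+ m) i j.

(** [(M^k)_ij <= (M^k)_ij (M^m)_ji <= (M^(k+m))_ii], which is at most the trace
    of [M^(k+m)]. Passing through the trace avoids the polynomial factor that
    Jordan blocks would give. *)
Lemma expmx_le k i j : ((M ^+ k) i j)%:~R <= n%:R * b ^+ (k + m).
Proof.
apply: le_trans (mxtrace_exp_le (k + m) b_max).
rewrite map_mx_intr_exp trace_map_mx.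
apply: le_trans (real_ler_norm (realz _ _)).
rewrite ler_int.
apply: (@le_trans _ _ ((M ^+ (k + m)) i i)).
  rewrite exprD -mulmxE mxE (bigD1 j) //=.
  apply: ler_wpDr; first by rewrite sumr_ge0 // => l _;
    rewrite mulr_ge0 ?expmx_ge0.
  by rewrite ler_peMr ?expmx_ge0 // -gtz0_ge1.
rewrite /mxtrace (bigD1 i) //= lerDl sumr_ge0 // => l _; exact: expmx_ge0.
Qed.

(** Take absolute values in [x M^k = b^k x] for an eigenvector [x], and sum the
    entries. *)
Lemma expmx_sum_ge k : root (char_poly MC) b ->
  b ^+ k <= \sum_i \sum_j ((M ^+ k) i j)%:~R.
Proof.
move=> rb; have b0 : 0 <= b by apply: le_trans (b_max rb).
move: (rb); rewrite -eigenvalue_root_char => /eigenvalueP [x xM x0].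
have xMk : x *m MC ^+ k = b ^+ k *: x.
  elim: k => [|k IH]; first by rewrite !expr0 mulmx1 scale1r.
  by rewrite exprSr -mulmxE mulmxA IH -scalemxAl xM scalerA exprSr.
pose S := \sum_i `|x 0 i|.
have S0 : 0 < S.
  rewrite lt_def sumr_ge0 ?andbT; last by [].
  apply: contra_neq x0 => S0; apply/rowP => i; rewrite mxE.
  apply/eqP; rewrite -normr_eq0.
  by move/eqP: S0; rewrite psumr_eq0 // => /allP /(_ i);
    rewrite mem_index_enum => /(_ isT).
rewrite -(ler_pM2r S0).
have -> : b ^+ k * S = \sum_j `|(x *m MC ^+ k) 0 j|.
  by rewrite xMk mulr_sumr; apply: eq_bigr => j _;
    rewrite mxE normrM ger0_norm ?exprn_ge0.
rewrite map_mx_intr_exp.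
apply: (@le_trans _ _ (\sum_j \sum_i `|x 0 i| * ((M ^+ k) i j)%:~R)).
  apply: ler_sum => j _; rewrite mxE (le_trans (ler_norm_sum _ _ _)) //.
  by apply: ler_sum => i _;
    rewrite mxE normrM [`|_%:~R|]ger0_norm // ler0z expmx_ge0.
rewrite exchange_big mulr_suml; apply: ler_sum => i _ /=.
rewrite -mulr_sumr mulrC ler_wpM2l //; last first.
  by rewrite /S (bigD1 i) //= lerDl sumr_ge0.
by rewrite sumr_ge0 // => j _; rewrite ler0z expmx_ge0.
Qed.

(** All entries of [M^m] are at least [1], so [M^(2m)] has entries at least [n]
    and trace at least [n^2], while its trace is at most [n b^(2m)]. *)
Lemma perron_gt1 : (1 < n)%N -> root (char_poly MC) b -> 1 < b.
Proof.
move=> n1 rb; have b0 : 0 <= b by apply: le_trans (b_max rb).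
have : n%:R <= b ^+ (m + m).
  have n0 : 0 < n%:R :> C by rewrite ltr0n (ltn_trans _ n1).
  rewrite -(ler_pM2l n0); apply: le_trans (mxtrace_exp_le (m + m) b_max).
  rewrite map_mx_intr_exp trace_map_mx.
  apply: le_trans (real_ler_norm (realz _ _)).
  rewrite -natrM pmulrn ler_int.
  apply: (@le_trans _ _ (\sum_(i < n) \sum_(j < n) 1%:Z)).
    by rewrite !sumr_const !card_ord -mulrnA -mulr_natr; lia.
  apply: ler_sum => i _; rewrite exprD -mulmxE mxE; apply: ler_sum => j _.
  by rewrite -gtz0_ge1 mulr_gt0.
have b1 : b \is Num.real by rewrite realE b0.
rewrite real_ltNge ?rpred1 // => nb; apply/negP => b_le1.
have := le_trans nb (exprn_ile1 _ b0 b_le1); rewrite (ler_nat C n 1); lia.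
Qed.
End PrimitiveMatrix.

Lemma Cayley_Hamilton_sum (R : comNzRingType) n (M : 'M[R]_n) :
  \sum_(i < size (char_poly M)) (char_poly M)`_i *: M ^+ i = 0.
Proof.
case: n M => [|n] M; first by apply/matrixP; case.
rewrite -[RHS](Cayley_Hamilton M).
rewrite -[in RHS](coefK (char_poly M)) poly_def linear_sum /=.
by apply: eq_bigr => i _; rewrite linearZ /= rmorphXn /= horner_mx_X.
Qed.

Section Lengths.
Variables (C : numClosedFieldType) (n : nat) (M : 'M[int]_n) (v : 'cV[int]_n).
Hypothesis M_ge0 : forall i j, 0 <= M i j.
Hypothesis v_ge0 : forall i, 0 <= v i 0.
Local Notation MC := (map_mx (intr : int -> C) M).
Local Notation chi := (char_poly M).

Definition orbit_sum k : int := \sum_i (M ^+ k *m v) i 0.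

Lemma orbit_sum_rec k : \sum_(i < size chi) chi`_i * orbit_sum (k + i) = 0.
Proof.
have E : M ^+ k *m (\sum_(i < size chi) chi`_i *: M ^+ i) *m v = 0.
  by rewrite Cayley_Hamilton_sum mulmx0 mul0mx.
transitivity (\sum_l (M ^+ k *m (\sum_(i < size chi) chi`_i *: M ^+ i) *m v) l
  0).
  rewrite mulmx_sumr mulmx_suml.
  under [RHS]eq_bigr do rewrite summxE.
  rewrite exchange_big /=; apply: eq_bigr => i _.
  rewrite /orbit_sum mulr_sumr; apply: eq_bigr => l _.
  by rewrite -scalemxAr -scalemxAl [RHS]mxE exprD mulmxE.
by rewrite E big1 // => l _; rewrite mxE.
Qed.

Variables (b : C) (m : nat).
Hypothesis b_max : forall l, root (char_poly MC) l -> `|l| <= b.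
Hypothesis Mm_gt0 : forall i j, 0 < (M ^+ m) i j.

Lemma orbit_sum_le : exists K, forall k, (orbit_sum k)%:~R <= K * b ^+ k.
Proof.
exists (\sum_(i < n) \sum_j n%:R * b ^+ m * (v j 0)%:~R) => k.
rewrite /orbit_sum rmorph_sum mulr_suml ler_sum // => i _ /=.
rewrite mxE rmorph_sum mulr_suml ler_sum // => j _ /=.
rewrite rmorphM /= mulrAC ler_wpM2r ?ler0z //.
by rewrite -mulrA -exprD addnC; exact: expmx_le.
Qed.

Lemma orbit_sum_lower k : root (char_poly MC) b -> v != 0 ->
  b ^+ k <= (orbit_sum (k + m))%:~R.
Proof.
move=> rb v0; apply: le_trans (expmx_sum_ge M_ge0 b_max k rb) _.
have [j vj] : exists j, 1 <= v j 0.
  apply: contrapT => /forallNP H; case/eqP: v0; apply/colP => j; rewrite mxE.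
  apply/eqP; move: (v_ge0 j) (H j); rewrite le_eqVlt eq_sym gtz0_ge1.
  by case/orP.
rewrite /orbit_sum rmorph_sum ler_sum // => i _ /=.
rewrite exprD -mulmxE -mulmxA mxE rmorph_sum ler_sum // => l _ /=.
rewrite ler_int ler_peMr ?expmx_ge0 // mxE (bigD1 j) //=.
rewrite ler_wpDr //.
  by rewrite sumr_ge0 // => i' _; rewrite mulr_ge0 // expmx_ge0.
by rewrite -gtz0_ge1 mulr_gt0 // gtz0_ge1.
Qed.
End Lengths.

(** * The characteristic polynomial and its roots *)

Section Spectrum.
Variables (R : realType) (n : nat) (M : 'M[int]_n).
Local Notation C := (Cplx R).
Local Notation chi := (map_poly (intr : int -> Cplx R) (char_poly M)).

Lemma spectrum_prod : chi = \prod_(l <- spectrum R M) ('X - l%:P).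
Proof.
rewrite {1}(svalP (closed_field_poly_normal chi)) -/(spectrum R M).
rewrite (_ : lead_coef _ = 1) ?scale1r //.
by rewrite -[chi]/(map_poly (intr : {rmorphism int -> C}) _) map_char_poly;
  apply/monicP/char_poly_monic.
Qed.

Lemma mem_spectrum l : (l \in spectrum R M) = root chi l.
Proof. by rewrite spectrum_prod root_prod_XsubC. Qed.

Lemma spectrum_simple l : count_mem l (spectrum R M) = 1%N -> chi^`().[l] != 0.
Proof.
move=> c1; have lin : l \in spectrum R M by rewrite -has_pred1 has_count c1.
have E := perm_to_rem lin.
rewrite spectrum_prod (perm_big _ E) big_cons derivM hornerD !hornerM.
rewrite derivXsubC !hornerE subrr mul0r addr0 -rootE root_prod_XsubC.
have := permP E (pred1 l); rewrite c1 /= eqxx add1n => -[] /esym/count_memPn.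
by [].
Qed.
End Spectrum.

(** * Coordinates of a recurrent sequence along a root *)

Definition rec_eval (L : pzRingType) (q : {poly int}) (s : nat -> L) k : L :=
  \sum_(i < size q) (q`_i)%:~R * s (k + i)%N.

(** If [q = (X - x) h], this is [\sum_j h_j s_(k+j)], with the coefficients of
    [h] written out in terms of [x]. For [s] satisfying the recurrence of [q]
    and [x] a simple root, it is [q'(x)] times the term in [x^k] of [s k]. The
    formula makes sense for every [x], and is polynomial in [x] with
    coefficients in the ring generated by the values of [s]: this is what allows
    conjugate roots to be compared. *)
Definition root_coord (L : comNzRingType) (q : {poly int}) (s : nat -> L)
  (x : L) k : L :=
  \sum_(i < size q) (q`_i)%:~R * \sum_(j < i) x ^+ (i.-1 - j) * s (k + j)%N.

Lemma root_coordS (L : comNzRingType) (q : {poly int}) (s : nat -> L)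
  (x : L) k :
  root_coord q s x k.+1 - x * root_coord q s x k =
  rec_eval q s k - (map_poly intr q).[x] * s k.
Proof.
rewrite /root_coord /rec_eval mulr_sumr -sumrB.
rewrite /map_poly horner_poly mulr_suml -sumrB; apply: eq_bigr => i _.
rewrite mulrCA -mulrBr -mulrA -mulrBr; congr (_ * _).
pose F j := x ^+ (i - j) * s (k + j)%N.
transitivity (\sum_(0 <= j < i) (F j.+1 - F j)).
  rewrite big_mkord mulr_sumr -sumrB; apply: eq_bigr => j _.
  rewrite /F addSnnS mulrA -exprS; congr (_ ^+ _ * _ - _ ^+ _ * _);
    have := ltn_ord j; lia.
by rewrite telescope_sumr // /F subnn expr0 mul1r subn0 addn0.
Qed.

Lemma root_coord_rmorph (L L' : comNzRingType)
  (f : {rmorphism L -> L'}) q s x k :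
  f (root_coord q s x k) = root_coord q (f \o s) (f x) k.
Proof.
rewrite rmorph_sum; apply: eq_bigr => i _.
rewrite rmorphM rmorph_int rmorph_sum; congr (_ * _); apply: eq_bigr => j _.
by rewrite rmorphM rmorphXn.
Qed.

Lemma root_coordB (L : comNzRingType) q (a : L) s p x k :
  root_coord q (fun j => a * s j - p j) x k =
  a * root_coord q s x k - root_coord q p x k.
Proof.
rewrite /root_coord mulr_sumr -sumrB; apply: eq_bigr => i _.
rewrite mulrCA -mulrBr; congr (_ * _); rewrite mulr_sumr -sumrB.
by apply: eq_bigr => j _; ring.
Qed.

Lemma root_coord_geom (L : comNzRingType) q s (x : L) N :
  root (map_poly intr q) x -> (forall k, (N <= k)%N -> rec_eval q s k = 0) ->
  forall k, root_coord q s x (N + k) = x ^+ k * root_coord q s x N.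
Proof.
move=> /rootP qx qs; elim=> [|k IH]; first by rewrite addn0 mul1r.
have := root_coordS q s x (N + k); rewrite qx mul0r subr0 qs ?leq_addr //.
by move/eqP; rewrite subr_eq0 addnS => /eqP ->; rewrite IH mulrA exprS.
Qed.

(** The coordinate is multiplied by [x] at each step, so its modulus does not
    decrease; yet it is a fixed linear combination of terms that tend to [0]. *)
Lemma root_coord_vanish (C : numFieldType) q (s : nat -> C) (x : C) N :
  root (map_poly intr q) x -> 1 <= `|x| ->
  (forall k, (N <= k)%N -> rec_eval q s k = 0) ->
  (forall e, 0 < e -> exists N', forall k, (N' <= k)%N -> `|s k| <= e) ->
  root_coord q s x N = 0.
Proof.
move=> qx x1 qs s0.
pose K := 1 + \sum_(i < size q) `|(q`_i)%:~R| * \sum_(j < i) `|x| ^+ (i.-1 - j).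
have K0 : 0 < K.
  by rewrite ltr_pwDl // sumr_ge0 // => i _;
    rewrite mulr_ge0 // sumr_ge0 // => j _; rewrite exprn_ge0.
apply/eqP; rewrite -normr_le0; apply/negPn/negP => nle.
have D0 : 0 < `|root_coord q s x N|.
  by rewrite lt_def normr_ge0 andbT; apply: contra nle => /eqP ->.
pose e := `|root_coord q s x N| / (2 * K).
have e0 : 0 < e by rewrite divr_gt0 ?mulr_gt0.
have [N' N'P] := s0 e e0.
have : `|root_coord q s x (N + N')| <= K * e.
  rewrite /K mulrDl mul1r ler_wpDl ?(ltW e0) // /root_coord.
  rewrite (le_trans (ler_norm_sum _ _ _)) // mulr_suml ler_sum // => i _.
  rewrite normrM -mulrA ler_wpM2l // (le_trans (ler_norm_sum _ _ _)) //.
  rewrite mulr_suml ler_sum // => j _.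
  rewrite normrM normrX ler_wpM2l ?exprn_ge0 // N'P //; lia.
rewrite root_coord_geom // normrM normrX => h.
have h2 : `|root_coord q s x N| <= K * e.
  by apply: le_trans h; rewrite ler_peMl // exprn_ege1.
have : K * e = `|root_coord q s x N| / 2 by rewrite /e; field; rewrite gt_eqF.
move=> E; rewrite E ler_pdivlMr // in h2.
move: h2; rewrite -subr_ge0.
have -> : `|root_coord q s x N| - `|root_coord q s x N| * 2 = -
  `|root_coord q s x N| by ring.
by rewrite oppr_ge0 (negPf nle).
Qed.

Lemma cplx_archi (R : realType) (x : Cplx R) : 0 <= x -> exists n : nat,
  x < n%:R.
Proof.
case: x => a c; rewrite lecE /= => /andP [/eqP c0 a0].
exists (Num.bound a).
have -> : (Num.bound a)%:R = ((Num.bound a)%:R)%:C%C :> R[i]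
  by rewrite rmorph_nat.
by rewrite ltcE /= c0 eqxx archi_boundP.
Qed.

(** The two sums differ by [j] terms at each end. *)
Lemma sum_shift_le (C : numFieldType) (t : nat -> C) (K : C) :
  (forall k, 0 <= t k <= K) -> forall L j,
  `|\sum_(k < L) t k - \sum_(k < L) t (k + j)%N| <= j%:R * (K + K).
Proof.
move=> tK L; elim=> [|j IH].
  under [X in _ - X]eq_bigr do rewrite addn0.
  by rewrite subrr normr0 mul0r.
have E : \sum_(k < L) t (k + j.+1)%N = \sum_(k < L) t (k + j)%N +
  (t (L + j)%N - t j).
  elim: L {IH} => [|L IH]; first by rewrite !big_ord0 add0r add0n subrr.
  by rewrite !big_ord_recr /= IH addSnnS; ring.
rewrite E opprD addrA (le_trans (ler_normB _ _)) // -natr1 mulrDl mul1r lerD //.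
rewrite (le_trans (ler_normB _ _)) // lerD //.
  by have /andP [h1 h2] := tK (L + j)%N; rewrite ger0_norm.
by have /andP [h1 h2] := tK j; rewrite ger0_norm.
Qed.

(** Suppose a coordinate vanishes; then they all do. Put [t k = s k / b^k],
    which lies in [0, K]. Dividing the vanishing coordinate at [k] by [b^k]
    gives [\sum_i q_i b^(i-1) \sum_(j < i) t (k + j) = 0]. Summing over [k < L],
    and replacing each [\sum_(k < L) t (k + j)] by [T L = \sum_(k < L) t k] at
    the cost of a bounded error, one finds that [q'(b) * T L] is bounded. But [T
    L] is unbounded, since [t k >= b^-m] for [k >= m]. *)
Lemma root_coord_neq0 (R : realType) (q : {poly int}) (s : nat -> Cplx R)
    (b K : Cplx R) (m : nat) :
  0 < b -> (forall k, 0 <= s k) -> (forall k, s k <= K * b ^+ k) ->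
  (forall k, b ^+ k <= s (k + m)%N) ->
  (forall k, rec_eval q s k = 0) ->
  root (map_poly intr q) b -> (map_poly intr q)^`().[b] != 0 ->
  forall N, root_coord q s b N != 0.
Proof.
move=> b0 s0 sK sm sq qb dq N; apply/eqP => DN.
set d := _.[b] in dq.
have b_neq0 : b != 0 by rewrite gt_eqF.
have geom := root_coord_geom qb (fun k _ => sq k).
have D0 : root_coord q s b 0 = 0.
  by move: DN; rewrite -(add0n N) geom // => /eqP;
    rewrite mulf_eq0 expf_eq0 (negPf b_neq0) andbF /= => /eqP.
have D k : root_coord q s b k = 0 by rewrite -(add0n k) geom // D0 mulr0.
pose t k := s k / b ^+ k.
have tK k : 0 <= t k <= K.
  by rewrite divr_ge0 ?exprn_ge0 ?(ltW b0) // /t ler_pdivrMr ?exprn_gt0 ?sK.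
have Dt k : \sum_(i < size q) (q`_i)%:~R * b ^+ i.-1 * \sum_(j < i) t (k + j)%N
  = 0.
  transitivity (root_coord q s b k / b ^+ k); last by rewrite D mul0r.
  rewrite /root_coord mulr_suml.
  apply: eq_bigr => i _; rewrite -!mulrA; congr (_ * _).
  rewrite mulr_suml mulr_sumr; apply: eq_bigr => j _.
  have ji : (j <= i.-1)%N by have := ltn_ord j; lia.
  rewrite /t -{1}(subnK ji) !exprD; field.
  by rewrite !expf_neq0.
pose T L := \sum_(k < L) t k.
have dE : d = \sum_(i < size q) (q`_i)%:~R * b ^+ i.-1 * i%:R.
  rewrite /d /map_poly poly_def raddf_sum horner_sum; apply: eq_bigr => i _ /=.
  by rewrite derivZ derivXn hornerZ hornerMn hornerXn -mulrA mulr_natr.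
pose B := \sum_(i < size q) `|(q`_i)%:~R * b ^+ i.-1| * \sum_(j < i)
  (j%:R * (K + K)).
have dT L : `|d * T L| <= B.
  have -> : d * T L = \sum_(i < size q) (q`_i)%:~R * b ^+ i.-1 *
      \sum_(j < i) (T L - \sum_(k < L) t (k + j)%N).
    transitivity (d * T L - \sum_(k < L) \sum_(i < size q)
        (q`_i)%:~R * b ^+ i.-1 * \sum_(j < i) t (k + j)%N).
      by rewrite [X in _ - X]big1 ?subr0.
    rewrite exchange_big /= dE mulr_suml -sumrB; apply: eq_bigr => i _.
    rewrite -(mulr_sumr _ _ _ ((q`_i)%:~R * b ^+ i.-1)) -(mulrA _ i%:R)
      -mulrBr; congr (_ * _).
    by rewrite exchange_big /= sumrB sumr_const card_ord mulr_natl.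
  rewrite (le_trans (ler_norm_sum _ _ _)) // ler_sum // => i _.
  rewrite normrM ler_wpM2l // (le_trans (ler_norm_sum _ _ _)) // ler_sum // =>
    j _.
  exact: sum_shift_le.
have Tge L : L%:R / b ^+ m <= T (m + L)%N.
  rewrite /T big_split_ord /= ler_wpDl //.
    by rewrite sumr_ge0 // => k _; have /andP[] := tK k.
  rewrite -[X in X%:R](card_ord L) -sumr_const mulr_suml ler_sum // => k _.
  rewrite mul1r /t addnC exprD invfM mulrA ler_pMl ?invr_gt0 ?exprn_gt0 //.
  by rewrite ler_pdivlMr ?exprn_gt0 // mul1r.
have dn0 : 0 < `|d| by rewrite normr_gt0.
have B0 : 0 <= B by apply: le_trans (dT 0%N).
have [L LP] : exists L : nat, B * b ^+ m / `|d| < L%:R.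
  by apply: cplx_archi; rewrite divr_ge0 ?mulr_ge0 ?exprn_ge0 ?(ltW b0).
have T0 : 0 <= T (m + L)%N by rewrite sumr_ge0 // => k _; have /andP[] := tK k.
have := dT (m + L)%N; rewrite normrM (ger0_norm T0) => h.
have := le_trans (ler_wpM2l (ltW dn0) (Tge L)) h.
rewrite mulrA ler_pdivrMr ?exprn_gt0 // mulrC -ler_pdivlMr // => h2.
by have := lt_le_trans LP h2; rewrite ltxx.
Qed.

(** * Rotation numbers and nearest integers *)

Lemma expi2piX (R : realType) (a : R) n : expi2pi a ^+ n = expi2pi (n%:R * a).
Proof.
elim: n => [|n IH].
  by rewrite /expi2pi !mul0r !mulr0 cos0 sin0.
rewrite exprS IH /expi2pi -[n.+1%:R]natr1.
have -> : 2 * pi * ((n%:R + 1) * a) = 2 * pi * a + 2 * pi * (n%:R * a) by ring.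
rewrite cosD sinD; apply/eqP; rewrite eq_complex /=.
by apply/andP; split; apply/eqP; ring.
Qed.

Definition nearest_int (R : realType) (y : R) : int := Num.floor (y + 2^-1).

Lemma nearest_int_half (R : realType) (y : R) :
  `|y - (nearest_int y)%:~R| <= 2^-1.
Proof.
have /andP [] := floor_itv (y + 2^-1); rewrite -/(nearest_int y) intrD => h1 h2.
by rewrite ler_norml; apply/andP; split; lra.
Qed.

Lemma cos2pi_subz (R : realType) (y : R) (p : int) :
  cos (2 * pi * (y - p%:~R)) = cos (2 * pi * y).
Proof.
have per := periodicn (@cosD2pi R).
case: p => n.
  rewrite -[in LHS](per n) -(mulr_natr (pi *+ 2)) -(mulr_natr pi); congr cos.
  by rewrite -pmulrn; ring.
rewrite -[in RHS](per n.+1) NegzE mulrNz opprK -(mulr_natr (pi *+ 2))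
  -(mulr_natr pi); congr cos.
by rewrite -pmulrn; ring.
Qed.

(** With [t] the distance from [y] to the nearest integer, the real part of
    [1 - e^(2 i pi y)] is [1 - cos (2 pi t)], and [t] ranges in [0, 1/2], where
    this increases with [t]. *)
Lemma nearest_int_continuity (R : realType) (e : R) : 0 < e -> e <= 2^-1 ->
  exists2 d : R, 0 < d & forall y : R, `|expi2pi y - 1| < (d%:C)%C ->
    `|y - (nearest_int y)%:~R| < e.
Proof.
move=> e0 e2; have pi0 := pi_gt0 R.
have ine : 2 * pi * e \in `[0, pi].
  by rewrite in_itv /=; apply/andP; split; nra.
have in0 : (0 : R) \in `[0, pi] by rewrite in_itv /= lexx ltW.
exists (1 - cos (2 * pi * e)).
  by rewrite subr_gt0 -[ltRHS](cos0 R) ltr_cos //; nra.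
move=> y h; rewrite ltNge; apply/negP => le_e.
set t := `|_| in le_e; have t2 : t <= 2^-1 := nearest_int_half y.
have int : 2 * pi * t \in `[0, pi].
  by rewrite in_itv /=; apply/andP; split; nra.
have ct : cos (2 * pi * y) = cos (2 * pi * t).
  rewrite -(cos2pi_subz y (nearest_int y)) /t.
  by case: (ger0P (y - _)) => // _; rewrite mulrN cosN.
have : (`|cos (2 * pi * y) - 1|%:C)%C < ((1 - cos (2 * pi * e))%:C)%C :> R[i].
  by apply: le_lt_trans (normc_ge_Re (expi2pi y - 1)) h.
rewrite ltcR ltNge => /negP; apply.
rewrite distrC ger0_norm ?subr_ge0 ?cos_le1 // lerD2l lerN2 ct.
rewrite le_eqVlt; case: (ltgtP (2 * pi * e) (2 * pi * t)) => [lt|gt|->];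
  last by rewrite eqxx.
  by rewrite ltr_cos // lt orbT.
by nra.
Qed.

Lemma rec_eval_rmorph (L L' : pzRingType) (f : {rmorphism L -> L'}) q s k :
  f (rec_eval q s k) = rec_eval q (f \o s) k.
Proof.
rewrite rmorph_sum; apply: eq_bigr => i _.
by rewrite rmorphM rmorph_int.
Qed.

Lemma root_coord_poly (C : numFieldType) (q : {poly int}) (p : nat -> int) n :
  exists Q : {poly rat}, forall x : C,
    (map_poly ratr Q).[x] = root_coord q (fun k => (p k)%:~R) x n.
Proof.
exists (root_coord q (fun k => (p k)%:~R) 'X n) => x.
have cx : commr_rmorph (@ratr C) x by move=> y; exact: mulrC.
rewrite -/(horner_morph cx _) root_coord_rmorph /= horner_morphX.
rewrite /root_coord; apply: eq_bigr => i _; congr (_ * _);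
  apply: eq_bigr => j _.
by congr (_ * _); exact: rmorph_int.
Qed.

(** [Q] comes from the nearest integers [p k] to [s k * a]. The recurrence of
    [q] applied to [eps k = a * s k - p k] yields integers of modulus less than
    [1] for large [k], hence zeros; so the coordinates of [eps] at roots outside
    the open unit disc vanish. *)
Lemma eigenvalue_coord_poly (R : realType) (q : {poly int}) (s : nat -> nat)
  (a : R) :
  (forall k, rec_eval q (fun k => (s k)%:Z) k = 0) ->
  (forall e : Cplx R, 0 < e -> exists N, forall k, (N <= k)%N ->
     `|expi2pi a ^+ s k - 1| < e) ->
  exists N, forall n, (N <= n)%N -> exists Q : {poly rat}, forall x : Cplx R,
    root (map_poly intr q) x -> 1 <= `|x| ->
    (a%:C)%C * root_coord q (fun k => (s k)%:R) x n = (map_poly ratr Q).[x].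
Proof.
move=> qs sa.
pose p k := nearest_int ((s k)%:R * a).
pose eps k : R := a * (s k)%:R - (p k)%:~R.
have eps0 e : 0 < e -> e <= 2^-1 -> exists N, forall k, (N <= k)%N ->
  `|eps k| < e.
  move=> e0 e2; have [d d0 dP] := nearest_int_continuity e0 e2.
  have [|N NP] := sa (d%:C)%C; first by rewrite -(ltcR 0) in d0.
  exists N => k kN; rewrite /eps mulrC; apply: dP; rewrite -expi2piX; exact: NP.
pose K : R := 1 + \sum_(i < size q) `|(q`_i)%:~R|.
have K1 : 1 <= K by rewrite lerDl sumr_ge0.
have [||N NP] := eps0 (2 * K)^-1.
- by rewrite invr_gt0; lra.
- by rewrite lef_pV2 ?posrE; lra.
have rec0 k : (N <= k)%N -> rec_eval q eps k = 0.
  move=> kN.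
  have qsR : rec_eval q (fun k => (s k)%:R : R) k = 0.
    have := congr1 (fun z : int => z%:~R : R) (qs k).
    by rewrite (rec_eval_rmorph (intr : {rmorphism int -> R})).
  have E : rec_eval q eps k = - (rec_eval q p k)%:~R.
    rewrite (rec_eval_rmorph (intr : {rmorphism int -> R})).
    transitivity (a * rec_eval q (fun k => (s k)%:R : R) k - rec_eval q
      (intr \o p) k).
      rewrite /rec_eval mulr_sumr -sumrB; apply: eq_bigr => i _ /=.
      by rewrite /eps; ring.
    by rewrite qsR mulr0 add0r.
  have : `|rec_eval q eps k| < 1.
    apply: (@le_lt_trans _ _ (K * (2 * K)^-1)).
      have Ki : 0 <= (2 * K)^-1 by rewrite invr_ge0; lra.
      rewrite {1}/K mulrDl ler_wpDl ?mul1r //.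
      rewrite (le_trans (ler_norm_sum _ _ _)) // mulr_suml ler_sum // => i _.
      by rewrite normrM ler_wpM2l // ltW // NP //; lia.
    by rewrite invfM mulrCA mulfV ?mulr1; [lra|rewrite gt_eqF //; lra].
  rewrite E normrN -intr_norm -[1]/(1%:~R) ltr_int => h.
  by have -> : rec_eval q p k = 0; [lia|rewrite oppr0].
exists N => n nN.
have [Q QP] := root_coord_poly (Cplx R) q p n.
exists Q => x qx x1; rewrite QP; apply/eqP; rewrite -subr_eq0 -root_coordB;
  apply/eqP.
have E k : (eps k)%:C%C = (a%:C)%C * (s k)%:R - (p k)%:~R :> R[i].
  by rewrite /eps rmorphB rmorphM rmorph_nat rmorph_int.
apply: root_coord_vanish => // [k nk|e e0].
  have := congr1 (real_complex R) (rec0 k (leq_trans nN nk)).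
  rewrite (rec_eval_rmorph (real_complex R)) rmorph0 => <-.
  by apply: eq_bigr => i _ /=; rewrite -E.
have [c c0 ce] : exists2 c : R, 0 < c & (c%:C)%C <= e.
  case: e e0 => u w; rewrite ltcE /= => /andP[/eqP w0 u0]; exists u => //.
  by rewrite lecE /= w0 eqxx lexx.
have [||N' N'P] := eps0 (Num.min c 2^-1).
- by rewrite lt_min c0 invr_gt0 ltr0n.
- by rewrite ge_min lexx orbT.
exists N' => k kN; apply: le_trans ce; rewrite -E.
rewrite normc_def /= expr0n /= addr0 sqrtr_sqr lecR ltW //.
by have := N'P k kN; rewrite lt_min => /andP[].
Qed.

(** * Conjugates and the rank of the group of eigenvalues *)

(** A non-zero polynomial of least size among those vanishing at [x] generates
    their ideal; this gives a witness for the [xget] in [minpolyQ]. *)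
Lemma minpolyQ_spec (R : realType) (x : Cplx R) :
  (exists2 p : {poly rat}, p != 0 & root (map_poly ratr p) x) ->
  minpolyQ x \is monic /\
  forall q, root (map_poly ratr q) x = (minpolyQ x %| q).
Proof.
pose toC : {poly rat} -> {poly Cplx R} := map_poly ratr.
rewrite -/toC.
move=> [p0 p0n rp0].
suff [p pP] : exists p : {poly rat}, p \is monic /\ forall q,
  root (toC q) x = (p %| q).
  have := @xgetPex _ 0 [set p : {poly rat} | p \is monic /\ forall q :
    {poly rat},
    root (map_poly ratr q) x = (p %| q)]; apply; by exists p.
pose P n := `[< exists p : {poly rat},
  [/\ p != 0, root (toC p) x & size p = n] >].
have exP : exists n, P n by exists (size p0); apply/asboolP; exists p0.
case: (ex_minnP exP) => n /asboolP [p [pn rp sp]] nmin.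
have lp : lead_coef p != 0 by rewrite lead_coef_eq0.
have rpx : (toC p).[x] = 0 by exact/rootP.
exists ((lead_coef p)^-1 *: p); split.
  by rewrite monicE lead_coefZ mulVf.
move=> q; rewrite dvdpZl ?invr_eq0 //.
rewrite {1}(divp_eq q p) /toC rmorphD rmorphM /= rootE !hornerE rpx mulr0 add0r
  -rootE.
apply/idP/idP => [rq|/modp_eq0P ->]; last by rewrite rmorph0 root0.
apply/modp_eq0P/eqP/negPn/negP => qn.
have /nmin : P (size (q %% p)) by apply/asboolP; exists (q %% p).
by rewrite -sp leqNgt ltn_modp pn.
Qed.

(** Reduce the [Q i] modulo [mu]; their coefficients form a rational matrix with
    [d = deg mu] columns. Eliminating [alpha i] between the two relations shows
    that the column vector [w] kills it. This vector is not zero: its entries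
    [0] and [1] vanish together only if [beta = gamma]. Hence the matrix has
    rank less than [d], over [Q] as well as over the complex numbers. If [d <=
    k], its rows satisfy a non-trivial rational relation, which the [alpha i]
    inherit through the relations at [beta]. *)
Lemma conjugate_rank (R : realType) (k : nat) (alpha : 'I_k -> R)
  (mu g : {poly rat})
    (Q : 'I_k -> {poly rat}) (beta gamma : Cplx R) :
  let ev (p : {poly rat}) (x : Cplx R) := (map_poly ratr p).[x] in
  mu \is monic -> ev mu beta = 0 -> ev mu gamma = 0 -> gamma != beta ->
    ev g beta != 0 ->
  (forall i, (alpha i)%:C%C * ev g beta = ev (Q i) beta) ->
  (forall i, (alpha i)%:C%C * ev g gamma = ev (Q i) gamma) ->
  free_over_Q alpha -> (k < (size mu).-1)%N.
Proof.
move=> ev mon mub muc gb gn0 Qb Qc fr.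
pose d := (size mu).-1.
have mu0 : mu != 0 by exact: monic_neq0.
have d2 : (2 < size mu)%N.
  rewrite -(size_map_poly (ratr : {rmorphism rat -> Cplx R})).
  apply: (@max_poly_roots _ _ [:: gamma; beta]).
  - by rewrite map_poly_eq0.
  - by rewrite /= andbT; apply/andP; split; apply/eqP.
  - by rewrite /= inE gb.
have evmod p x : ev mu x = 0 ->
  ev p x = \sum_(j < d) ratr (p %% mu)`_j * x ^+ j.
  move=> mx; rewrite {1}(divp_eq p mu) /ev rmorphD rmorphM /= !hornerE.
  rewrite -/(ev mu x) mx mulr0 add0r.
  rewrite (@horner_coef_wide _ d).
    by apply: eq_bigr => j _; rewrite coef_map.
  by rewrite size_map_poly -ltnS prednK ?size_poly_gt0 // ltn_modp.
rewrite ltnNge; apply/negP => dk; rewrite -/d in dk.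
pose A : 'M[rat]_(k, d) := \matrix_(i, j) (Q i %% mu)`_j.
pose w : 'cV[Cplx R]_d :=
  \col_j (beta ^+ j * ev g gamma - gamma ^+ j * ev g beta).
have Aw : map_mx (ratr : rat -> Cplx R) A *m w = 0.
  apply/colP => i; rewrite [RHS]mxE mxE.
  transitivity (ev (Q i) beta * ev g gamma - ev (Q i) gamma * ev g beta).
    rewrite (evmod (Q i) _ mub) (evmod (Q i) _ muc) !mulr_suml -sumrB;
      apply: eq_bigr => j _.
    by rewrite !mxE; ring.
  by rewrite -Qb -Qc; ring.
have wn0 : w != 0.
  apply/eqP => w0.
  have d0 : (0 < d)%N by rewrite /d; lia.
  have d1 : (1 < d)%N by rewrite /d; lia.
  have e0 : ev g gamma = ev g beta.
    have := congr1 (fun z : 'cV_d => z (Ordinal d0) 0) w0; rewrite !mxE /=.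
    by rewrite !expr0 2!mul1r => /eqP; rewrite subr_eq0 => /eqP.
  have e1 : beta * ev g gamma - gamma * ev g beta = 0.
    by have := congr1 (fun z : 'cV_d => z (Ordinal d1) 0) w0; rewrite !mxE.
  move: e1; rewrite e0 -mulrBl => /eqP;
    rewrite mulf_eq0 (negPf gn0) orbF subr_eq0 eq_sym.
  by rewrite (negPf gb).
have nfull : ~~ row_free A.
  apply: contra wn0 => rf.
  have rkA : \rank A = d.
    apply/eqP; rewrite eqn_leq rank_leq_col /=; move: rf;
      rewrite /row_free => /eqP ->.
    exact: dk.
  have : row_full (map_mx (ratr : rat -> Cplx R) A)
    by rewrite row_full_map /row_full rkA.
  move=> /row_fullP [B BA].
  by rewrite -[w]mul1mx -BA -mulmxA Aw mulmx0.
move: nfull; rewrite -kermx_eq0 => /rowV0Pn [c /sub_kermxP cA c0].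
case/eqP: c0; apply/rowP => i; rewrite mxE.
apply: (fr (fun i => c 0 i)).
apply: (@complexI R); rewrite raddf_sum /= rmorph0.
apply: (mulIf gn0); rewrite mul0r mulr_suml.
transitivity (\sum_(i < k) ratr (c 0 i) * ev (Q i) beta).
  apply: eq_bigr => j _; rewrite rmorphM /= -mulrA Qb; congr (_ * _).
  exact: (fmorph_rat (real_complex R)).
under eq_bigr do rewrite (evmod _ _ mub) mulr_sumr.
rewrite exchange_big /= big1 // => j _.
have := congr1 (fun z : 'rV_d => ratr (z 0 j) : Cplx R) cA.
rewrite !mxE rmorph_sum rmorph0 /= => E.
rewrite -[RHS](mul0r (beta ^+ j)) -[in RHS]E mulr_suml; apply: eq_bigr => l _.
by rewrite rmorphM mxE mulrA.
Qed.

Theorem proposition8p1 (R : realType) (A : finType) (sigma : substitution A)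
    (beta : Cplx R) (k : nat) (alpha : 'I_k -> R) :
  (2 <= #|A|)%N ->
  primitive_substitution sigma ->
  pseudo_unimodular R sigma ->
  perron_eigenvalue (incidence_matrix sigma) beta ->
  ~ pisot beta ->
  free_over_Q alpha ->
  (forall i : 'I_k, subshift_eigenvalue sigma (expi2pi (alpha i))) ->
  (k < alg_degree beta)%N.
Proof.
move=> cardA prim _ [b_real b_simple b_max] not_pisot fr eig.
set M := incidence_matrix sigma in b_simple b_max.
have [m _ mP] := prim; rewrite -/M in mP.
pose q := char_poly M.
have qC : map_poly (intr : int -> Cplx R) q = char_poly
  (map_mx (intr : int -> Cplx R) M).
  by rewrite -[LHS]/(map_poly (intr : {rmorphism int -> Cplx R}) _)
    map_char_poly.
have M_ge0 i j : 0 <= M i j by rewrite mxE.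
have b_root : root (map_poly intr q) beta.
  by rewrite -mem_spectrum -has_pred1 has_count b_simple.
have b_maxC l : root (char_poly (map_mx (intr : int -> Cplx R) M)) l ->
  `|l| <= beta.
  by rewrite -qC -mem_spectrum; exact: b_max.
have b_rootC : root (char_poly (map_mx (intr : int -> Cplx R) M)) beta
  by rewrite -qC.
have b_gt1 : 1 < beta by exact: (perron_gt1 b_maxC mP cardA b_rootC).
have b_gt0 : 0 < beta by exact: lt_trans b_gt1.
have qratE : map_poly (ratr : rat -> Cplx R) (map_poly intr q) =
  map_poly intr q.
  by rewrite -map_poly_comp; apply: eq_map_poly => z /=; rewrite ratr_int.
have q_monic : q \is monic by exact: char_poly_monic.
have [mu_monic mu_dvd] : minpolyQ beta \is monic /\
    forall p, root (map_poly ratr p) beta = (minpolyQ beta %| p).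
  apply: minpolyQ_spec; exists (map_poly intr q); last by rewrite qratE.
  by apply: monic_neq0; apply: monic_map.
have mu_beta : root (map_poly ratr (minpolyQ beta)) beta
  by rewrite mu_dvd dvdpp.
(* [beta] is an algebraic integer greater than 1, so only the condition on
   conjugates can prevent it from being a Pisot number. *)
have [gamma [mu_gamma gb g1]] : exists gamma,
  [/\ root (map_poly ratr (minpolyQ beta)) gamma,
    gamma != beta & 1 <= `|gamma|].
  apply: contrapT => /forallNP H; apply: not_pisot; split=> //.
    by exists q.
  move=> g rg gb; rewrite real_ltNge ?rpred1 ?normr_real //.
  by apply/negP => g1; apply: (H g); split.
have gamma_root : root (map_poly intr q) gamma.
  have /dvdpP [h hE] : minpolyQ beta %| map_poly intr q
    by rewrite -mu_dvd qratE.
  by rewrite -qratE hE rmorphM rootM mu_gamma orbT.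
have [w w0 wP] := eigenvalue_return_times cardA prim R.
pose s j := size (iter j sigma w).
have sE j : (s j)%:Z = orbit_sum M (count_vec w) j.
  by rewrite size_count_vec count_vec_iter.
have v_ge0 i : 0 <= count_vec w i 0 by rewrite mxE.
have v0 : count_vec w != 0.
  apply: contra_neq w0 => v0; apply: size0nil.
  have := size_count_vec w; rewrite v0 big1; first by case.
  by move=> i _; rewrite mxE.
have s_rec j : rec_eval q (fun l => (s l)%:Z) j = 0.
  rewrite -[RHS](orbit_sum_rec M (count_vec w) j); apply: eq_bigr => i _.
  by rewrite sE intz.
have s_recC j : rec_eval q (fun l => (s l)%:R : Cplx R) j = 0.
  have := congr1 (fun z : int => z%:~R : Cplx R) (s_rec j).
  by rewrite (rec_eval_rmorph (intr : {rmorphism int -> Cplx R})).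
have nz N : root_coord q (fun l => (s l)%:R : Cplx R) beta N != 0.
  have [K KP] := orbit_sum_le M_ge0 v_ge0 b_maxC mP.
  apply: (@root_coord_neq0 _ _ _ _ K m) => //.
  - by move=> j; have := KP j; rewrite -sE.
  - by move=> j; have := orbit_sum_lower M_ge0 v_ge0 b_maxC mP j b_rootC v0;
    rewrite -sE.
  - exact: spectrum_simple.
have /choice [N NP] : forall i, exists N, forall n, (N <= n)%N ->
    exists Q : {poly rat}, forall x : Cplx R,
    root (map_poly intr q) x -> 1 <= `|x| ->
    ((alpha i)%:C)%C * root_coord q (fun j => (s j)%:R) x n =
      (map_poly ratr Q).[x].
  by move=> i; apply: eigenvalue_coord_poly s_rec _; apply: wP; exact: eig.
pose N0 := (\max_i N i)%N.
have /choice [Q QP] : forall i, exists Q : {poly rat}, forall x : Cplx R,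
    root (map_poly intr q) x -> 1 <= `|x| ->
    ((alpha i)%:C)%C * root_coord q (fun j => (s j)%:R) x N0 =
      (map_poly ratr Q).[x].
  by move=> i; apply: NP; exact: leq_bigmax.
have [g gP] := root_coord_poly (Cplx R) q (fun j => (s j)%:Z) N0.
have b_norm : 1 <= `|beta| by rewrite gtr0_norm // ltW.
apply: (@conjugate_rank R k alpha (minpolyQ beta) g Q beta gamma) => //.
- exact/rootP.
- exact/rootP.
- by rewrite gP; exact: nz.
- by move=> i; rewrite gP -QP.
- by move=> i; rewrite gP -QP.
Qed.
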